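(* Let $m_1=\mathrm{id}\in W_1$, $m_2=(1,2)\in W_2$, and $m_n=a_{n-1}\,x_{n-2}^{x_n}\in W_n$ for $n\ge3$. Let $M_1=\langle(1,2)\rangle$, $M_2=\langle (1,3,2,4),(1,2)\rangle$, and $M_n=\langle x_n,m_n,v_{n-3},\dots,v_0\rangle\le W_n$ for $n\ge3$. Then for every $n\ge1$ the group $M_n$ satisfies Model 3, i.e. for every partition $\lambda$ of $2^n$ the proportion of elements of $M_n$ with cycle type $\lambda$ equals the density of $\lambda$ in the level $n$ cycle data of Model 3.
   Context: $W_n$ is the automorphism group of the complete binary rooted tree of height $n$, regarded as a permutation group on its $2^n$ leaves labelled $1,\dots,2^n$ from left to right. Permutations are composed right to left, and $g^x=xgx^{-1}$. For $i\le n$, $W_i$ is regarded as a subgroup of $W_n$ acting on the leaves $1,\dots,2^i$ and fixing all others. Put $a_i=\prod_{j=1}^{2^{i-1}}(j,\,j+2^{i-1})$, $x_n=a_1a_2\cdots a_n\in W_n$, and $v_i=x_{i+2}^2$ for $i\ge0$. Model 3. Types are $nn,ns,sn,ss$. Level $n$ data is a finite collection of pairs (formal commutative product $\prod_i[t_i,d_i]$ with $t_i$ types and $\sum d_i=2^n$; density). The level 1 data is $([nn,2],\tfrac14),\ ([ss,2],\tfrac14),\ ([nn,1][nn,1],\tfrac18),\ ([ss,1][ss,1],\tfrac18),\ ([ns,1][sn,1],\tfrac14)$. Level $n+1$ data is obtained from level $n$ data by replacing, independently, each factor according to: $[nn,d]\to[nn,2d]$; $[ns,d]\to[ss,2d]$;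 $[sn,d]\to[nn,d][ss,d]$; $[ss,d]\to[nn,d][nn,d]$ or $[ss,d][ss,d]$, the two alternatives being equally likely; densities multiply accordingly. The level $n$ cycle data assigns to each partition $\lambda$ of $2^n$ the sum of the densities of the products whose multiset of $d_i$ is $\lambda$. *)

(* Defs.v *)
From mathcomp Require Import all_boot all_order all_algebra all_fingroup.
From mathcomp Require Import zify.

Set Implicit Arguments.
Unset Strict Implicit.
Unset Printing Implicit Defensive.

Import GroupScope.

(* Leaves of the tree of height n are the elements of 'I_(2 ^ n); the leaf
   labelled j (1 <= j <= 2 ^ n) is the ordinal j - 1.  Other values of j wrap
   around modulo 2 ^ n and are never used. *)
Lemma expn2_gt0 n : 0 < 2 ^ n.
Proof. by rewrite expn_gt0. Qed.

Definition leaf (n j : nat) : 'I_(2 ^ n) :=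
  Ordinal (ltn_pmod j.-1 (expn2_gt0 n)).

(* Two leaves i, j have the same ancestor k levels above the leaves iff
   i %/ 2 ^ k = j %/ 2 ^ k; an automorphism of the tree is a permutation of
   the leaves compatible with all these equivalence relations. *)
Definition tree_aut (n : nat) : {set 'S_(2 ^ n)} :=
  [set g : 'S_(2 ^ n) |
    [forall k : 'I_n.+1, forall i : 'I_(2 ^ n), forall j : 'I_(2 ^ n),
      (g i %/ 2 ^ k == g j %/ 2 ^ k) == (i %/ 2 ^ k == j %/ 2 ^ k)]].

Lemma tree_autP n (g : 'S_(2 ^ n)) :
  reflect (forall (k : nat) (i j : 'I_(2 ^ n)), k <= n ->
             (g i %/ 2 ^ k == g j %/ 2 ^ k) = (i %/ 2 ^ k == j %/ 2 ^ k))
          (g \in tree_aut n).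
Proof.
rewrite inE; apply: (iffP idP) => [H k i j lekn | H].
  have ltkn : k < n.+1 by [].
  by move/forallP/(_ (Ordinal ltkn))/forallP/(_ i)/forallP/(_ j)/eqP: H.
apply/forallP=> k; apply/forallP=> i; apply/forallP=> j; apply/eqP.
by apply: H; rewrite -ltnS.
Qed.

Lemma tree_aut_group_set n : group_set (tree_aut n).
Proof.
apply/group_setP; split=> [|g h /tree_autP Hg /tree_autP Hh].
  by apply/tree_autP=> k i j _; rewrite !perm1.
by apply/tree_autP=> k i j lekn; rewrite !permM Hh // Hg.
Qed.

Canonical treeW (n : nat) : {group 'S_(2 ^ n)} := Group (tree_aut_group_set n).

(* In MathComp (g * h) z = h (g z), whereas a_1 a_2 ... a_k and the other
   products below are meant for the convention in which the rightmost factor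
   acts first.  All products are therefore written in reverse order, and
   x g x^-1 becomes g ^ x = x^-1 * g * x. *)

Definition aW (n i : nat) : 'S_(2 ^ n) :=
  \prod_(1 <= j < (2 ^ i.-1).+1) tperm (leaf n j) (leaf n (j + 2 ^ i.-1)).

(* xW n k is the element a_1 a_2 ... a_k of W_k, acting on the first 2 ^ k
   of the 2 ^ n leaves. *)
Definition xW (n k : nat) : 'S_(2 ^ n) :=
  \prod_(i <- rev (index_iota 1 k.+1)) aW n i.

Definition vW (n i : nat) : 'S_(2 ^ n) := xW n i.+2 ^+ 2.

Definition mW (n : nat) : 'S_(2 ^ n) :=
  match n with
  | 0 | 1 => 1
  | 2 => tperm (leaf 2 1) (leaf 2 2)
  | n => xW n (n - 2) ^ xW n n * aW n (n - 1)
  end.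

(* The cycle (s_1, s_2, ..., s_r), mapping each entry of s to the next one. *)
Definition cycle_perm (T : finType) (s : seq T) (Us : uniq s) : {perm T} :=
  perm (can_inj (prev_next Us)).

Lemma uniq_1324 : uniq [:: leaf 2 1; leaf 2 3; leaf 2 2; leaf 2 4].
Proof. by []. Qed.

(* Only n >= 1 is meaningful. *)
Definition grpM (n : nat) : {group 'S_(2 ^ n)} :=
  match n with
  | 0 => 1%G
  | 1 => <<[set tperm (leaf 1 1) (leaf 1 2)]>>%G
  | 2 => <<[set cycle_perm uniq_1324; tperm (leaf 2 1) (leaf 2 2)]>>%G
  | n => <<[set xW n n; mW n] :|: [set vW n i | i : 'I_(n - 2)]>>%G
  end.

(* The orbit sizes of g, fixed points included, in nonincreasing order. *)
Definition cycle_type (T : finType) (g : {perm T}) : seq nat :=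
  sort geq [seq #|A| | A : {set T} <- enum (porbits g)].

Definition is_partition (N : nat) (lam : seq nat) : bool :=
  [&& sorted geq lam, 0 \notin lam & sumn lam == N].

Inductive ftype := nn | ns | sn | ss.

(* A formal commutative product of factors [t, d] is represented by the list
   of its factors in some order, and level data by a list of (product, density)
   pairs in which the same product may occur several times. *)
Definition factor := (ftype * nat)%type.
Definition fproduct := seq factor.
Definition level_data := seq (fproduct * rat).

Section Model3.
Local Open Scope ring_scope.

Definition level1 : level_data :=
  [:: ([:: (nn, 2%N)], 1 / 4%:R);
      ([:: (ss, 2%N)], 1 / 4%:R);
      ([:: (nn, 1%N); (nn, 1%N)], 1 / 8%:R);
      ([:: (ss, 1%N); (ss, 1%N)], 1 / 8%:R);
      ([:: (ns, 1%N); (sn, 1%N)], 1 / 4%:R)].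

Definition step_factor (f : factor) : level_data :=
  let: (t, d) := f in
  match t with
  | nn => [:: ([:: (nn, (2 * d)%N)], 1)]
  | ns => [:: ([:: (ss, (2 * d)%N)], 1)]
  | sn => [:: ([:: (nn, d); (ss, d)], 1)]
  | ss => [:: ([:: (nn, d); (nn, d)], 1 / 2%:R);
              ([:: (ss, d); (ss, d)], 1 / 2%:R)]
  end.

Definition step_product (p : fproduct) : level_data :=
  foldr (fun f D => [seq (o.1 ++ r.1, o.2 * r.2) | o <- step_factor f, r <- D])
        [:: ([::], 1)] p.

Definition step_level (D : level_data) : level_data :=
  [seq (r.1, e.2 * r.2) | e <- D, r <- step_product e.1].

(* Meaningful for n >= 1. *)
Definition model3 (n : nat) : level_data := iter n.-1 step_level level1.

Definition cycle_density (n : nat) (lam : seq nat) : rat :=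
  \sum_(e <- model3 n | perm_eq [seq f.2 | f <- e.1] lam) e.2.

Definition proportion (T : finType) (G : {group {perm T}}) (lam : seq nat) :
    rat :=
  #|[set g in G | cycle_type g == lam]|%:R / #|G|%:R.

End Model3.

Local Open Scope nat_scope.

Lemma aWE n i (z : 'I_(2 ^ n)) : 0 < i <= n ->
  aW n i z = (if z < 2 ^ i.-1 then z + 2 ^ i.-1
              else if z < 2 ^ i then z - 2 ^ i.-1 else z) :> nat.
Proof.
case: i => // i /= ltin.
have le2 : 2 * 2 ^ i <= 2 ^ n by rewrite -expnS leq_exp2l.
have vleaf j : 0 < j <= 2 ^ n -> leaf n j = j.-1 :> nat.
  by move=> Hj /=; rewrite modn_small //; lia.
rewrite /aW [2 ^ i.+1]expnS /=; set h := 2 ^ i in le2 *.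
suff H k : k <= h ->
    (\prod_(1 <= j < k.+1) tperm (leaf n j) (leaf n (j + h)))%g z
    = (if z < k then z + h else if h <= z < h + k then z - h else z) :> nat.
  by rewrite H //; do ?case: ifP; lia.
have zn := ltn_ord z.
elim: k z zn => [|k IH] z zn lek; first by rewrite big_geq // perm1; do ?case: ifP; lia.
rewrite big_nat_recr //= permM.
have {}IH := IH z zn (ltnW lek).
have l1 : leaf n k.+1 = k :> nat by rewrite vleaf //; lia.
have l2 : leaf n (k.+1 + h) = k + h :> nat by rewrite vleaf //; lia.
move: IH; move: (_ z) => y IH.
case: tpermP => [yE|yE|/eqP y1 /eqP y2].
- rewrite l2; move: IH; rewrite yE l1.
  by do ?case: ifP; lia.
- rewrite l1; move: IH; rewrite yE l2.
  by do ?case: ifP; lia.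
move: y1 y2; rewrite -!val_eqE /= -/(nat_of_ord _).
rewrite !modn_small; try lia.
by move: IH; do ?case: ifP; lia.
Qed.

Lemma aW_tree n i : 0 < i <= n -> aW n i \in treeW n.
Proof.
move=> Hi; apply/tree_autP=> k z w _.
rewrite !aWE //; case: i Hi => //= i _.
have [ltik|leki] := ltnP i k.
  have H (u : nat) : (if u < 2 ^ i then u + 2 ^ i
      else if u < 2 ^ i.+1 then u - 2 ^ i else u) %/ 2 ^ k = u %/ 2 ^ k.
    have le : 2 ^ i.+1 <= 2 ^ k by rewrite leq_exp2l.
    move: le; rewrite expnS; move: (2 ^ i) (2 ^ k) => b c le.
    do ?case: ifP => *; last by [].
      by rewrite !divn_small //; lia.
    by rewrite !divn_small //; lia.
  by rewrite !H.
have H (u : nat) : (if u < 2 ^ i then u + 2 ^ i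
      else if u < 2 ^ i.+1 then u - 2 ^ i else u) %/ 2 ^ k =
      let q := u %/ 2 ^ k in let r := 2 ^ (i - k) in
      (if q < r then q + r else if q < 2 * r then q - r else q).
  have E : 2 ^ i = 2 ^ (i - k) * 2 ^ k by rewrite -expnD subnK.
  have p0 := expn2_gt0 k.
  rewrite /= expnS E mulnA !ltn_divLR //.
  case: ifP => // _; first by rewrite addnC divnMDl // addnC.
  by case: ifP => // _; rewrite divnBMl.
rewrite !H /=; set q := z %/ _; set q' := w %/ _.
by apply/eqP/eqP; do ?case: ifP; lia.
Qed.

Lemma xW_tree n k : k <= n -> xW n k \in treeW n.
Proof.
move=> lekn; rewrite /xW big_seq; apply: group_prod => i.
by rewrite mem_rev mem_index_iota => Hi; apply: aW_tree; lia.
Qed.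

Lemma tperm12_tree n : 0 < n -> tperm (leaf n 1) (leaf n 2) \in treeW n.
Proof.
move=> n0; suff <- : aW n 1 = tperm (leaf n 1) (leaf n 2) by apply: aW_tree.
by rewrite /aW big_nat1.
Qed.

Lemma cycle_1324 : cycle_perm uniq_1324 = xW 2 2.
Proof.
apply/permP=> z; apply: val_inj; rewrite permE /xW /index_iota /rev /=.
rewrite big_cons big_seq1 permM !aWE //.
by case: z => [[|[|[|[|?]]]]].
Qed.

Lemma mW_tree n : mW n \in treeW n.
Proof.
case: n => [|[|[|n]]]; rewrite /mW ?group1 //; first exact: tperm12_tree.
by rewrite groupM ?groupJ ?xW_tree ?aW_tree //; lia.
Qed.

Lemma grpM_tree n : grpM n \subset treeW n.
Proof.
case: n => [|[|[|n]]]; rewrite /grpM ?sub1G // gen_subG.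
- by rewrite sub1set tperm12_tree.
- by rewrite subUset !sub1set cycle_1324 xW_tree // tperm12_tree.
rewrite !subUset !sub1set mW_tree xW_tree //=.
apply/subsetP=> _ /imsetP[i _ ->]; have lti := ltn_ord i.
by rewrite groupX // xW_tree //; move: lti; lia.
Qed.

(* Main.v *)
Require Import Defs.
From mathcomp Require Import all_boot all_order all_algebra all_fingroup.
From mathcomp Require Import zify ring.

Set Implicit Arguments.
Unset Strict Implicit.
Unset Printing Implicit Defensive.

(** Write an element of height n+1 as a triple (g, h, e): g and h act on the
    two halves of the tree, then the halves are exchanged if e = 1 and kept if
    e = 0; in products the left factor acts first.  The generators become
    x_(n+1) = (1, x_n, 1), m_n = (a_(n-1), (x_(n-2), 1, 0), 0) and
    v_i = (v_i, 1, 0).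

    The letters n and s of a factor [t, d] stand for odd (1) and even (0): t = (b, b')
    records the parities of the action on the first two levels of the subtree.
    The elements in question are constrained at all deeper levels as well.
    Recursively, (g, h, b) is of type (b, b') if g is of type (c, c) and h of
    type (c + b', c + b') for some c ([has_type]).  This is the branching rule
    of Model 3.  If b is even, the cycles of the triple are those of g and of h,
    and c is a fair coin.  If b is odd, they are the cycles of h g with lengths
    doubled, and h g is again a uniform element, of type (b', b').  Induction on
    the height therefore identifies the cycle type of a random element of type t
    with the offspring of the factor [t, d] ([expect_offspring]).

    The group M_(n+1) consists exactly of the triples (g, h, e) with g of type
    (b, b') and h of type (b' + e, b + e), where e, b, b' are arbitrary
    ([in_M]); this top vertex produces the level 1 data ([expect_model3]).  The
    generators are of this form.  Conversely, the elements of type (even, even)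
    form the least subgroup that contains the v_i and is normalised by x_n
    ([even_gen]); inside M_(n+1) this yields all triples (g, h, 0) with g
    and h of that type, and multiplying by m, x and x^2 reaches the remaining
    types ([in_M_gen]).

    Counting elements is replaced by a recursively defined mean value
    ([mean], [meanM]).  Its invariance under translations shows at once that
    h g is uniform in the doubling step, and that [meanM] is the uniform mean
    over M_(n+1) ([meanM_uniform]); no cardinality is computed, and small
    heights, where several types contain the same element, need no separate
    treatment. *)

(** * Tree automorphisms as triples *)

Section Wreath.
Import GroupScope.
Local Open Scope nat_scope.

Lemma node_subproof n (b : bool) (z : 'I_(2 ^ n)) : b * 2 ^ n + z < 2 ^ n.+1.
Proof. by have := ltn_ord z; rewrite expnS; case: b; lia. Qed.

Definition node n (b : bool) (z : 'I_(2 ^ n)) : 'I_(2 ^ n.+1) :=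
  Ordinal (node_subproof b z).

Lemma nodeP n (w : 'I_(2 ^ n.+1)) : exists b z, w = node b z :> 'I_(2 ^ n.+1).
Proof.
exists (2 ^ n <= w), (Ordinal (ltn_pmod w (expn2_gt0 n))); apply: val_inj => /=.
have := ltn_ord w; rewrite [X in _ < X]expnS mul2n -addnn => ltw.
case: leqP => [lew|?]; last by rewrite modn_small.
by rewrite -[X in X %% _](subnK lew) modnDr modn_small; lia.
Qed.

Lemma node_inj n b b' (z z' : 'I_(2 ^ n)) :
  node b z = node b' z' -> b = b' /\ z = z'.
Proof.
move=> /(congr1 val) /=; have := ltn_ord z; have := ltn_ord z'.
by case: b; case: b' => *; split=> //; try apply: val_inj; move=> /=; lia.
Qed.

Definition wr_fun n (g h : 'S_(2 ^ n)) (e : bool) (w : 'I_(2 ^ n.+1)) :=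
  let z := Ordinal (ltn_pmod w (expn2_gt0 n)) in
  let b := 2 ^ n <= w in node (b (+) e) ((if b then h else g) z).

Lemma wr_funE n (g h : 'S_(2 ^ n)) e b z :
  wr_fun g h e (node b z) = node (b (+) e) ((if b then h else g) z).
Proof.
rewrite /wr_fun /=; set z' := Ordinal _.
have -> : z' = z.
  by apply: val_inj; rewrite /= modnMDl modn_small.
have := ltn_ord z => ltz.
suff -> : (2 ^ n <= b * 2 ^ n + z) = b by [].
by case: b {z'}; lia.
Qed.

Lemma wr_inj n (g h : 'S_(2 ^ n)) e : injective (wr_fun g h e).
Proof.
move=> w w'; have [b [z ->]] := nodeP w; have [b' [z' ->]] := nodeP w'.
rewrite !wr_funE => /node_inj [/addIb <-].
by case: b => /perm_inj ->.
Qed.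

Definition wr n (g h : 'S_(2 ^ n)) (e : bool) : 'S_(2 ^ n.+1) :=
  perm (@wr_inj n g h e).

Lemma wrE n (g h : 'S_(2 ^ n)) e b z :
  wr g h e (node b z) = node (b (+) e) ((if b then h else g) z).
Proof. by rewrite permE wr_funE. Qed.

Lemma wr_eqP n (s : 'S_(2 ^ n.+1)) (g h : 'S_(2 ^ n)) e :
  (forall b (z : 'I_(2 ^ n)), s (node b z) = node (b (+) e) ((if b then h else g) z)) ->
  s = wr g h e.
Proof. by move=> H; apply/permP=> w; have [b [z ->]] := nodeP w; rewrite H wrE. Qed.

Lemma wrM n (g h g' h' : 'S_(2 ^ n)) e e' :
  (wr g h e * wr g' h' e' =
  wr (g * if e then h' else g') (h * if e then g' else h') (e (+) e'))%g.
Proof.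
apply: wr_eqP => b z; rewrite permM !wrE addbA; congr node.
by case: b; case: e; rewrite permM.
Qed.

Lemma wr1 n : wr 1 1 false = 1%g :> 'S_(2 ^ n.+1).
Proof. by apply/esym/wr_eqP=> b z; rewrite addbF if_same !perm1. Qed.

Lemma wrV n (g h : 'S_(2 ^ n)) e :
  ((wr g h e)^-1 = wr (if e then h else g)^-1 (if e then g else h)^-1 e)%g.
Proof.
apply/esym/eqP; rewrite eq_sym eq_invg_mul wrM addbb -wr1.
by case: e; rewrite !mulgV.
Qed.

Lemma ord_height0 (z w : 'I_(2 ^ 0)) : z = w.
Proof. by apply: val_inj; case: z w => [[]// ?] [[]//]. Qed.

Lemma perm_height0 (g : 'S_(2 ^ 0)) : g = 1%g.
Proof. by apply/permP=> z; apply: ord_height0. Qed.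

Lemma aW_wr n i : 0 < i <= n -> aW n.+1 i = wr (aW n i) 1 false.
Proof.
move=> Hi; apply: wr_eqP => b z; apply: val_inj => /=; rewrite aWE; last lia.
have le2 : 2 * 2 ^ i.-1 <= 2 ^ n by rewrite -expnS leq_exp2l //; lia.
have E : 2 ^ i = 2 * 2 ^ i.-1 by rewrite -expnS prednK //; lia.
rewrite E /=; case: b => /=; last by rewrite aWE // E.
by rewrite perm1; do ?case: ifP => //; lia.
Qed.

Lemma aW_top n : aW n.+1 n.+1 = wr 1 1 true.
Proof.
apply: wr_eqP => b z; apply: val_inj => /=; rewrite aWE ?leqnn //=.
have := ltn_ord z; rewrite expnS if_same perm1.
by case: b => /= ?; do ?case: ifP; lia.
Qed.

Lemma xW_rec n k :
  (xW n k.+1 = aW n k.+1 * xW n k)%g.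
Proof.
rewrite /xW /index_iota !subn1 [_.-1]/=.
have -> : iota 1 k.+1 = rcons (iota 1 k) k.+1 by rewrite -(addn1 k) iotaD cats1 addnC.
by rewrite rev_rcons big_cons.
Qed.

Lemma xW_wr n k : k <= n -> xW n.+1 k = wr (xW n k) 1 false.
Proof.
elim: k => [|k IH] lekn; first by rewrite /xW !big_nil wr1.
by rewrite !xW_rec IH 1?ltnW // aW_wr // wrM mulg1.
Qed.

Lemma xW_top n : xW n.+1 n.+1 = wr 1 (xW n n) true.
Proof. by rewrite xW_rec aW_top xW_wr // wrM !mul1g. Qed.

Lemma xW_sqr n :
  (xW n.+1 n.+1 ^+ 2 = wr (xW n n) (xW n n) false)%g.
Proof. by rewrite xW_top expgS expg1 wrM mul1g mulg1. Qed.

Lemma vW_wr n i : i.+2 <= n -> vW n.+1 i = wr (vW n i) 1 false.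
Proof. by move=> lein; rewrite /vW xW_wr // !expgS !expg0 !mulg1 wrM mulg1. Qed.

Lemma mW_wr n : mW n.+3 = wr (wr 1 1 true) (wr (xW n.+1 n.+1) 1 false) false.
Proof.
rewrite /mW !subSS !subn0 /= aW_wr ?leqnn // aW_top [xW _ n.+1]xW_wr //.
rewrite [xW _ n.+1]xW_wr // (xW_top n.+2) conjgE.
by rewrite wrV !wrM /= invg1 !mul1g !mulg1 ?mulVg ?mul1g.
Qed.

End Wreath.

(** * Cycle types of triples *)

Section CycleType.
Import GroupScope.

Lemma perm_enum_imset (T U : finType) (f : T -> U) (A : {set T}) :
  {in A &, injective f} -> perm_eq (enum (f @: A)) (map f (enum A)).
Proof.
move=> injf; apply: uniq_perm; first exact: enum_uniq.
  by rewrite map_inj_in_uniq ?enum_uniq // => x y; rewrite !mem_enum; apply: injf.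
move=> y; rewrite mem_enum; apply/imsetP/mapP => -[x]; rewrite ?mem_enum => Ax ->;
  by exists x; rewrite ?mem_enum.
Qed.

Lemma porbit_semiconj (T U : finType) (s : {perm T}) (u : {perm U}) (f : U -> T) x :
  (forall x, s (f x) = f (u x)) -> porbit s (f x) = f @: porbit u x.
Proof.
move=> sf; have sfX i : (s ^+ i) (f x) = f ((u ^+ i) x).
  by elim: i => [|i IH]; rewrite ?perm1 // !expgSr !permM IH sf.
apply/setP=> y; apply/porbitP/imsetP => [[i ->]|[_ /porbitP[i ->] ->]].
  by exists ((u ^+ i) x) => //; apply: mem_porbit.
by exists i.
Qed.

(** Even and odd powers of s; applied to an s exchanging two halves, the two
    pieces are the traces of the orbit on the halves. *)
Lemma porbit_sqr (T : finType) (s : {perm T}) x :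
  porbit s x = porbit (s ^+ 2) x :|: s @: porbit (s ^+ 2) x.
Proof.
apply/setP=> y; rewrite inE; apply/porbitP/orP => [[i ->]|].
  rewrite -[i]odd_double_half addnC -mul2n expgD expgM permM.
  case: (odd i); last by left; rewrite perm1 mem_porbit.
  by right; rewrite imset_f // mem_porbit.
case=> [/porbitP[i ->]|/imsetP[_ /porbitP[i ->] ->]].
  by exists (2 * i)%N; rewrite expgM.
by exists (2 * i)%N.+1; rewrite (expgSr s (2 * i)) permM expgM.
Qed.

Lemma cycle_type_sizes (T : finType) (g : {perm T}) :
  perm_eq (cycle_type g) [seq #|A| | A : {set T} <- enum (porbits g)].
Proof. by rewrite perm_sort. Qed.

Lemma node_imset_inj n b : injective (fun A : {set 'I_(2 ^ n)} => node b @: A).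
Proof. by apply: imset_inj => x y /node_inj[]. Qed.

Lemma card_node n b (A : {set 'I_(2 ^ n)}) : #|node b @: A| = #|A|.
Proof. by rewrite card_imset // => x y /node_inj[]. Qed.

Lemma cycle_type_wr0 n (g h : 'S_(2 ^ n)) :
  perm_eq (cycle_type (wr g h false)) (cycle_type g ++ cycle_type h).
Proof.
have orbE b z : porbit (wr g h false) (node b z) =
    node b @: porbit (if b then h else g) z.
  by apply: porbit_semiconj => x; rewrite wrE addbF.
have porbE : enum (porbits (wr g h false)) =i
    [seq node false @: A | A : {set _} <- enum (porbits g)]
    ++ [seq node true @: A | A : {set _} <- enum (porbits h)].
  move=> A; rewrite mem_enum mem_cat; apply/imsetP/orP.
    move=> [w _ ->]; have [b [z ->]] := nodeP w; rewrite orbE.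
    by case: b; [right|left]; apply: map_f; rewrite mem_enum imset_f.
  by case=> /mapP[B]; rewrite mem_enum => /imsetP[z _ ->] ->;
    [exists (node false z)|exists (node true z)]; rewrite ?orbE.
rewrite (permPl (cycle_type_sizes _)).
apply: perm_trans (perm_map _ _) _.
  apply: uniq_perm porbE; first exact: enum_uniq.
  rewrite cat_uniq !map_inj_uniq ?enum_uniq ?andbT //; try exact: node_imset_inj.
  apply/hasPn=> _ /mapP[B + ->]; rewrite mem_enum => /imsetP[z _ ->].
  apply/negP=> /mapP[A _] /setP/(_ (node true z)).
  rewrite imset_f ?porbit_id // => /esym/imsetP[w _] /node_inj[].
  by [].
rewrite map_cat -!map_comp; apply: perm_cat;
  rewrite perm_sym (permPl (cycle_type_sizes _))
    (@eq_map _ _ _ (fun A : {set _} => #|A|)) //;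
  by move=> A /=; rewrite card_node.
Qed.

(** The square of (g, h, 1) acts on the right half as h g, so each of its
    orbits meets the right half in an orbit of h g and the left half in the
    image of that orbit. *)
Lemma cycle_type_wr1 n (g h : 'S_(2 ^ n)) :
  perm_eq (cycle_type (wr g h true)) [seq (2 * d)%N | d <- cycle_type (h * g)].
Proof.
set s := wr g h true.
pose dbl (A : {set 'I_(2 ^ n)}) := node true @: A :|: node false @: (h @: A).
have orbE z : porbit s (node true z) = dbl (porbit (h * g) z).
  rewrite porbit_sqr (@porbit_semiconj _ _ (s ^+ 2) (h * g)) => [|x]; last first.
    by rewrite expgS expg1 !permM !wrE.
  by rewrite /dbl -!imset_comp; congr (_ :|: _); apply: eq_imset => x /=; rewrite wrE.
have dbl_inj : injective dbl.
  have dblE A x : (node true x \in dbl A) = (x \in A).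
    rewrite inE mem_imset; last by move=> ? ? /node_inj[].
    by apply/orb_idr => /imsetP[y _ /node_inj[]].
  by move=> A B eqAB; apply/setP=> x; rewrite -!dblE eqAB.
rewrite (permPl (cycle_type_sizes _)).
have -> : porbits s = dbl @: porbits (h * g).
  apply/setP=> A; apply/imsetP/imsetP => [[w _ ->]|[_ /imsetP[z _ ->] ->]]; last first.
    by exists (node true z); rewrite ?orbE.
  have [[] [z ->]] := nodeP w; first by exists (porbit (h * g) z); rewrite ?imset_f.
  exists (porbit (h * g) (g z)); rewrite ?imset_f // -orbE.
  have -> : node true (g z) = s (node false z) by rewrite wrE.
  by apply/eqP; rewrite eq_porbit_mem porbit_sym; apply: (mem_porbit s 1).
apply: perm_trans (perm_map _ (perm_enum_imset (in2W dbl_inj))) _.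
rewrite -map_comp (permPr (perm_map _ (cycle_type_sizes _))) -map_comp.
rewrite (@eq_map _ _ _ (fun A : {set _} => 2 * #|A|)%N) // => A /=.
rewrite cardsU !card_node card_imset; last exact: perm_inj.
have -> : node true @: A :&: node false @: (h @: A) = set0; last first.
  by rewrite cards0 subn0 addnn mul2n.
apply/setP=> w; rewrite !inE; apply/negP=> /andP[/imsetP[x _ ->] /imsetP[y _]].
by move=> /node_inj[].
Qed.

End CycleType.

(** * The elements of each type and the group M *)

Section Types.
Import GroupScope.

(** The booleans b and b' are the signs at the first two levels, true meaning
    odd.  A sign at a level below the leaves is not visible in the action and is
    left free: an element stands for the truncation of a deeper automorphism. *)
Fixpoint has_type n (b b' : bool) : 'S_(2 ^ n) -> Prop :=
  match n with
  | 0 => fun _ => True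
  | n.+1 => fun g => exists c g0 g1,
      [/\ has_type c c g0, has_type (c (+) b') (c (+) b') g1 & g = wr g0 g1 b]
  end.

Lemma has_typeM n b b' c c' (g h : 'S_(2 ^ n)) :
  has_type b b' g -> has_type c c' h -> has_type (b (+) c) (b' (+) c') (g * h).
Proof.
elim: n b b' c c' g h => [|n IH] b b' c c' g h //=.
move=> [d [g0 [g1 [Tg0 Tg1 ->]]]] [e [h0 [h1 [Th0 Th1 ->]]]]; rewrite wrM.
have [u [Tu0 Tu1]] : exists u, has_type u u (if b then h1 else h0) /\
    has_type (u (+) c') (u (+) c') (if b then h0 else h1).
  by case: b; [exists (e (+) c'); rewrite -addbA addbb addbF | exists e].
exists (d (+) u), (g0 * if b then h1 else h0), (g1 * if b then h0 else h1).
split=> //; first exact: IH.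
by rewrite addbACA; apply: IH.
Qed.

Lemma has_typeV n b b' (g : 'S_(2 ^ n)) : has_type b b' g -> has_type b b' g^-1.
Proof.
elim: n b b' g => [|n IH] b b' g //=.
move=> [c [g0 [g1 [Tg0 Tg1 ->]]]]; rewrite wrV.
case: b; last by exists c, g0^-1, g1^-1; split=> //; apply: IH.
exists (c (+) b'), g1^-1, g0^-1; split=> //; first exact: IH.
by rewrite -addbA addbb addbF; apply: IH.
Qed.

Lemma has_type1 n : has_type false false (1 : 'S_(2 ^ n)).
Proof. by elim: n => //= n IH; exists false, 1, 1; rewrite wr1. Qed.

Lemma has_type_x n : has_type true true (xW n n).
Proof.
elim: n => //= n IH; exists false, 1, (xW n n).
by split; rewrite ?xW_top //; apply: has_type1.
Qed.

Lemma has_type_v n i : i.+2 <= n -> has_type false false (vW n i).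
Proof.
elim: n => [|n IH] //; rewrite leq_eqVlt => /orP[/eqP <-|lein].
  by rewrite /vW expgS expg1; apply: (has_typeM (has_type_x _) (has_type_x _)).
exists false, (vW n i), 1; rewrite vW_wr //; split=> //; last exact: has_type1.
exact: IH.
Qed.

Lemma has_type_a n : has_type true false (aW n n).
Proof.
case: n => //= n; exists false, 1, 1; rewrite aW_top.
by split=> //; apply: has_type1.
Qed.

(** The elements of M_(n+1), described without generators. *)
Definition in_M n (g : 'S_(2 ^ n.+1)) : Prop := exists b b' e g0 g1,
  [/\ has_type b b' g0, has_type (b' (+) e) (b (+) e) g1 & g = wr g0 g1 e].

Lemma wr_group_set n (G : {group 'S_(2 ^ n.+1)}) (b : bool) :
  group_set [set g : 'S_(2 ^ n) |
    wr (if b then 1 else g) (if b then g else 1) false \in G].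
Proof.
apply/group_setP; split=> [|g h]; rewrite !inE; first by rewrite if_same wr1.
move=> Gg /(groupM Gg); rewrite wrM; congr (wr _ _ _ \in G);
  by case: b {Gg}; rewrite ?mulg1.
Qed.
Definition half_group n (G : {group 'S_(2 ^ n.+1)}) b := Group (@wr_group_set n G b).

Lemma half_groupE n (G : {group 'S_(2 ^ n.+1)}) g :
  (g \in half_group G false) = (wr g 1 false \in G).
Proof. by rewrite inE. Qed.

(** Conjugation by x carries the left half to the right half. *)
Lemma conj_x_half n (G : {group 'S_(2 ^ n.+1)}) g :
  xW n.+1 n.+1 \in 'N(G) -> (g \in half_group G true) = (g \in half_group G false).
Proof.
move=> nGx; rewrite !inE -[in RHS](memJ_norm _ nGx); congr (_ \in G).
by rewrite xW_top conjgE wrV !wrM invg1 !mul1g !mulg1 mulVg.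
Qed.

(** Since x_(n+1)^2 acts as x_n on both halves, normality passes to the halves;
    this drives the induction of [even_gen]. *)
Lemma x_norm_half n (G : {group 'S_(2 ^ n.+1)}) :
  xW n.+1 n.+1 \in 'N(G) -> xW n n \in 'N(half_group G false).
Proof.
move=> nGx; rewrite inE; apply/subsetP=> _ /imsetP[g + ->]; rewrite !half_groupE.
have nGx2 : xW n.+1 n.+1 ^+ 2 \in 'N(G) by rewrite groupX.
rewrite -(memJ_norm _ nGx2) xW_sqr; congr (_ \in G).
by rewrite !conjgE wrV !wrM mul1g mulVg.
Qed.

Lemma wr_in n (G : {group 'S_(2 ^ n.+1)}) g h :
  xW n.+1 n.+1 \in 'N(G) -> g \in half_group G false -> h \in half_group G false ->
  wr g h false \in G.
Proof.
move=> nGx Gg; rewrite -conj_x_half // => Gh; rewrite !inE in Gg Gh.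
by have := groupM Gg Gh; rewrite wrM mulg1 mul1g.
Qed.

(** By induction G contains the elements acting on one half as an even element.
    It remains to reach a pair of odd elements, which differs from the pair
    (x, x) = x_(n+1)^2 = v_(n-1) by even elements. *)
Lemma even_gen n (G : {group 'S_(2 ^ n)}) :
  (forall i, i.+2 <= n -> vW n i \in G) -> xW n n \in 'N(G) ->
  forall g, has_type false false g -> g \in G.
Proof.
elim: n G => [|n IH] G Gv nGx g; first by rewrite (perm_height0 g).
have {}IH h : has_type false false h -> h \in half_group G false.
  apply: IH; last exact: x_norm_half.
  by move=> i lein; rewrite half_groupE -vW_wr // Gv // ltnW.
move=> [c [g0 [g1 [T0 T1 ->]]]]; rewrite addbF in T1.
case: c T0 T1 => T0 T1; last by apply: wr_in => //; apply: IH.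
set x := xW n n.
have Tx : has_type true true x^-1 by apply/has_typeV/has_type_x.
have Gxx : wr x x false \in G.
  (* at height 1 the element v_(n-1) does not exist, but x is trivial *)
  rewrite /x; clear -Gv; case: n G Gv => [|n] G Gv.
    by rewrite (perm_height0 (xW 0 0)) wr1.
  by rewrite -xW_sqr; apply: (Gv n).
have -> : wr g0 g1 false = wr (g0 * x^-1) (g1 * x^-1) false * wr x x false.
  by rewrite wrM !mulgKV.
rewrite groupM // wr_in //; apply: IH; first exact: (has_typeM T0 Tx).
exact: (has_typeM T1 Tx).
Qed.

(** The quotient of M by the pairs of even elements has order at most 8: e is
    removed by x, then b' by x^2, then b by m. *)
Lemma in_M_gen n (G : {group 'S_(2 ^ n.+1)}) y :
  xW n.+1 n.+1 \in G -> has_type false true y -> wr (aW n n) y false \in G ->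
  (forall i, i.+2 <= n -> vW n.+1 i \in G) ->
  forall g, in_M g -> g \in G.
Proof.
move=> Gx Ty Gm Gv; have nGx := subsetP (normG G) _ Gx.
have IH h : has_type false false h -> h \in half_group G false.
  apply: even_gen; last exact: x_norm_half.
  by move=> i lein; rewrite half_groupE -vW_wr // Gv // ltnW.
set x := xW n n; have Tx : has_type true true x^-1 by apply/has_typeV/has_type_x.
have base b g0 g1 : has_type b false g0 -> has_type false b g1 -> wr g0 g1 false \in G.
  case: b => T0 T1; last by rewrite wr_in //; apply: IH.
  have -> : wr g0 g1 false =
      wr (g0 * (aW n n)^-1) (g1 * y^-1) false * wr (aW n n) y false.
    by rewrite wrM !mulgKV.
  rewrite groupM // wr_in //; apply: IH.
    by apply: (has_typeM T0 (has_typeV (has_type_a n))).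
  by apply: (has_typeM T1 (has_typeV Ty)).
have split_level b b' g0 g1 :
    has_type b b' g0 -> has_type b' b g1 -> wr g0 g1 false \in G.
  case: b' => T0 T1; last exact: base T0 T1.
  have -> : wr g0 g1 false = wr (g0 * x^-1) (g1 * x^-1) false * wr x x false.
    by rewrite wrM !mulgKV.
  rewrite groupM -?xW_sqr ?groupX //; apply: (base (~~ b)).
    by have := has_typeM T0 Tx; rewrite addbT.
  by have := has_typeM T1 Tx; rewrite !addbT.
move=> _ [b [b' [[] [g0 [g1 [T0 T1 ->]]]]]]; last first.
  by rewrite !addbF in T1; apply: split_level T0 T1.
have -> : wr g0 g1 true = wr g0 (g1 * x^-1) false * wr 1 x true.
  by rewrite wrM mulg1 mulgKV.
rewrite groupM -?xW_top //; apply: (split_level b b') => //.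
by have := has_typeM T1 Tx; rewrite !addbT !negbK.
Qed.

End Types.

(** * Mean values *)

Section Mean.
Import GRing.Theory Num.Theory.
Local Open Scope ring_scope.

(** The mean of F over the random element of type (b, b') obtained by tossing a
    fair coin for each c in the recursion of [has_type]. *)
Fixpoint mean n (b b' : bool) : ('S_(2 ^ n) -> rat) -> rat :=
  match n with
  | 0 => fun F => F 1%g
  | n.+1 => fun F => 1 / 2%:R * \sum_(c : bool)
      mean c c (fun g => mean (c (+) b') (c (+) b') (fun h => F (wr g h b)))
  end.

Lemma mean_eq n b b' (F F' : 'S_(2 ^ n) -> rat) :
  (forall g, has_type b b' g -> F g = F' g) -> mean b b' F = mean b b' F'.
Proof.
elim: n b b' F F' => [|n IH] b b' F F' eqF /=; first exact: eqF.
congr (_ * _); apply: eq_bigr => c _; apply: (IH) => g Tg; apply: (IH) => h Th.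
by apply: eqF; exists c, g, h.
Qed.

Lemma mean_cst n b b' (a : rat) : mean b b' (fun _ : 'S_(2 ^ n) => a) = a.
Proof.
elim: n b b' => [|n IH] b b' //=.
by under eq_bigr do rewrite !IH; rewrite big_bool /=; field.
Qed.

Lemma mean_sum n b b' I (r : seq I) (P : pred I) (F : I -> 'S_(2 ^ n) -> rat) :
  mean b b' (fun g => \sum_(i <- r | P i) F i g) = \sum_(i <- r | P i) mean b b' (F i).
Proof.
elim: n b b' F => [|n IH] b b' F //=.
rewrite -mulr_sumr exchange_big /=; congr (_ * _); apply: eq_bigr => c _.
by rewrite -IH; apply: mean_eq => g _; rewrite IH.
Qed.

Lemma big_bool_shift (F : bool -> rat) (d : bool) :
  \sum_(c : bool) F (c (+) d) = \sum_(c : bool) F c.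
Proof. by case: d; rewrite !big_bool //= addrC. Qed.

(** The mean is uniform: right translation by an element of type (c, c') turns
    the type (b, b') into (b + c, b' + c').  In the recursion it amounts to
    shifting the coin c by the sign of the component that multiplies g. *)
Lemma mean_mulr n b b' c c' (k : 'S_(2 ^ n)) (F : 'S_(2 ^ n) -> rat) :
  has_type c c' k ->
  mean b b' (fun g => F (g * k)%g) = mean (b (+) c) (b' (+) c') F.
Proof.
elim: n b b' c c' k F => [|n IH] b b' c c' k F.
  by rewrite /= (perm_height0 k) mulg1.
move=> [d [k0 [k1 [T0 T1 ->]]]] /=; congr (_ * _).
have [u [Tu0 Tu1]] : exists u, has_type u u (if b then k1 else k0) /\
    has_type (u (+) c') (u (+) c') (if b then k0 else k1).
  by case: b; [exists (d (+) c'); rewrite -addbA addbb addbF | exists d].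
rewrite -[RHS](big_bool_shift _ u); apply: eq_bigr => e _.
rewrite -(IH _ _ _ _ _ _ Tu0); apply: mean_eq => g _.
rewrite addbACA -(IH _ _ _ _ _ _ Tu1); apply: mean_eq => h _.
by rewrite wrM.
Qed.

Definition meanM n (F : 'S_(2 ^ n.+1) -> rat) : rat :=
  1 / 8%:R * \sum_(e : bool) \sum_(b : bool) \sum_(b' : bool)
    mean b b' (fun g => mean (b' (+) e) (b (+) e) (fun h => F (wr g h e))).

Lemma meanM_eq n (F F' : 'S_(2 ^ n.+1) -> rat) :
  (forall g, in_M g -> F g = F' g) -> meanM F = meanM F'.
Proof.
move=> eqF; congr (_ * _); apply: eq_bigr => e _; apply: eq_bigr => b _.
apply: eq_bigr => b' _; apply: mean_eq => g Tg; apply: mean_eq => h Th.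
by apply: eqF; exists b, b', e, g, h.
Qed.

Lemma meanM_cst n (a : rat) : meanM (fun _ : 'S_(2 ^ n.+1) => a) = a.
Proof.
rewrite /meanM; under eq_bigr => e _ do under eq_bigr => b _ do
  under eq_bigr => b' _ do rewrite mean_cst mean_cst.
by rewrite !big_bool /=; field.
Qed.

Lemma meanM_sum n I (r : seq I) (P : pred I) (F : I -> 'S_(2 ^ n.+1) -> rat) :
  meanM (fun g => \sum_(i <- r | P i) F i g) = \sum_(i <- r | P i) meanM (F i).
Proof.
rewrite /meanM -mulr_sumr; congr (_ * _).
rewrite [RHS]exchange_big /=; apply: eq_bigr => e _.
rewrite [RHS]exchange_big /=; apply: eq_bigr => b _.
rewrite [RHS]exchange_big /=; apply: eq_bigr => b' _.
rewrite -mean_sum; apply: mean_eq => g _.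
exact: mean_sum.
Qed.

Lemma meanM_mulr n (k : 'S_(2 ^ n.+1)) (F : 'S_(2 ^ n.+1) -> rat) :
  in_M k -> meanM (fun g => F (g * k)%g) = meanM F.
Proof.
move=> [d [d' [f [k0 [k1 [T0 T1 ->]]]]]]; congr (_ * _).
rewrite -[RHS](big_bool_shift _ f); apply: eq_bigr => e _.
have [u [u' [Tu Tu']]] : exists u u', has_type u u' (if e then k1 else k0) /\
    has_type (u' (+) f) (u (+) f) (if e then k0 else k1).
  case: e; last by exists d, d'.
  by exists (d' (+) f), (d (+) f); rewrite -!addbA !addbb !addbF.
rewrite -[RHS](big_bool_shift _ u); apply: eq_bigr => b _.
rewrite -[RHS](big_bool_shift _ u'); apply: eq_bigr => b' _.
rewrite -(mean_mulr _ _ _ Tu); apply: mean_eq => g _.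
rewrite ![_ (+) (e (+) f)]addbACA -(mean_mulr _ _ _ Tu'); apply: mean_eq => h _.
by rewrite wrM.
Qed.

(** One set of generators for all heights: also M_1 and M_2 have the form
    required by [in_M_gen], with y trivial. *)
Lemma grpM_gens n :
  exists2 S : {set 'S_(2 ^ n.+1)}, grpM n.+1 = <<S>>%G &
    (forall g, g \in S -> in_M g) /\
    exists y, [/\ has_type false true y, xW n.+1 n.+1 \in <<S>>%g,
      wr (aW n n) y false \in <<S>>%g &
      forall i, (i.+2 <= n)%N -> vW n.+1 i \in <<S>>%g].
Proof.
have in_Mx m : in_M (xW m.+1 m.+1).
  exists false, false, true, 1%g, (xW m m); split; last exact: xW_top.
    exact: has_type1.
  exact: has_type_x.
case: n => [|[|n]].
- exists [set tperm (leaf 1 1) (leaf 1 2)] => //.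
  have -> : tperm (leaf 1 1) (leaf 1 2) = xW 1 1.
    by rewrite /xW /index_iota big_seq1 /aW big_nat1.
  split; first by move=> g; rewrite inE => /eqP ->.
  exists 1%g; split=> //; first by rewrite mem_gen ?inE.
  by rewrite (perm_height0 (aW 0 0)) wr1 group1.
- exists [set cycle_perm uniq_1324; tperm (leaf 2 1) (leaf 2 2)] => //.
  rewrite cycle_1324; have -> : tperm (leaf 2 1) (leaf 2 2) = wr (aW 1 1) 1 false.
    by rewrite -aW_wr // /aW big_nat1.
  have T1 : has_type false true (1%g : 'S_(2 ^ 1)).
    by exists false, 1%g, 1%g; rewrite wr1.
  split.
    move=> g; rewrite !inE => /orP[]/eqP -> //.
    exists true, false, false, (aW 1 1), 1%g; split=> //; exact: has_type_a.
  by exists 1%g; split=> //; rewrite mem_gen // !inE eqxx ?orbT.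
exists ([set xW n.+3 n.+3; mW n.+3] :|: [set vW n.+3 i | i : 'I_(n.+3 - 2)]) => //.
rewrite mW_wr -aW_top.
have Ty : has_type false true (wr (xW n.+1 n.+1) 1 false).
  exists true, (xW n.+1 n.+1), 1%g; split=> //; first exact: has_type_x.
  exact: has_type1.
split.
  move=> g; rewrite !inE -orbA => /or3P[/eqP->|/eqP->|/imsetP[i _ ->]] //.
    exists true, false, false, (aW n.+2 n.+2), (wr (xW n.+1 n.+1) 1 false).
    by split=> //; apply: has_type_a.
  have lei : (i.+2 <= n.+2)%N by have := ltn_ord i; lia.
  exists false, false, false, (vW n.+2 i), 1%g.
  by split; [apply: has_type_v | apply: has_type1 | apply: vW_wr].
exists (wr (xW n.+1 n.+1) 1 false); split=> //; try by rewrite mem_gen // !inE eqxx ?orbT.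
move=> i lei; have lti : (i < n.+3 - 2)%N by lia.
by rewrite mem_gen // inE; apply/orP; right; apply/imsetP; exists (Ordinal lti).
Qed.

(** A mean value supported on a group and invariant under its translations is
    the uniform one: average the translates F (g k) over all k in the group. *)
Lemma meanM_uniform n (F : 'S_(2 ^ n.+1) -> rat) :
  meanM F = (\sum_(g in grpM n.+1) F g) / #|grpM n.+1|%:R.
Proof.
have [S -> [S_M [y [Ty Sx Sm Sv]]]] := grpM_gens n.
have inv F' k : k \in <<S>>%g -> meanM (fun g => F' (g * k)%g) = meanM F'.
  move=> /gen_prodgP[m [s Ss ->]].
  elim: m s Ss F' => [|m IH] s Ss F'.
    by rewrite big_ord0; apply: meanM_eq => g _; rewrite mulg1.
  rewrite big_ord_recr /= -[RHS](meanM_mulr _ (S_M _ (Ss ord_max))).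
  rewrite -(IH (fun i => s (widen_ord (leqnSn m) i)) (fun i => Ss _)
    (fun g => F' (g * s ord_max)%g)).
  by apply: meanM_eq => g _; rewrite mulgA.
set G := <<S>>%G; have G0 : #|G|%:R != 0 :> rat by rewrite pnatr_eq0 -lt0n cardG_gt0.
apply: (mulIf G0); rewrite divfK // mulr_natr -sumr_const.
under eq_bigr => k Gk do rewrite -(inv F k Gk).
rewrite -meanM_sum -[RHS](@meanM_cst n); apply: meanM_eq => g /in_M_gen Gg.
rewrite [RHS](reindex_inj (mulgI g)) /=.
by apply: eq_bigl => k; rewrite groupMl // (Gg G y).
Qed.

End Mean.

(** * The branching process of Model 3 *)

Section Model.
Import GRing.Theory.
Local Open Scope ring_scope.

Definition expect (D : level_data) (f : fproduct -> rat) : rat :=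
  \sum_(e <- D) e.2 * f e.1.

Definition offspring n (p : fproduct) : level_data :=
  iter n step_level [:: (p, 1)].

Lemma expect_eq D f f' : f =1 f' -> expect D f = expect D f'.
Proof. by move=> eqf; apply: eq_bigr => e _; rewrite eqf. Qed.

Lemma expect_exchange D D' (f : fproduct -> fproduct -> rat) :
  expect D (fun p => expect D' (f p)) = expect D' (fun q => expect D (f^~ q)).
Proof.
rewrite /expect; under eq_bigr => e _ do rewrite mulr_sumr.
rewrite exchange_big; apply: eq_bigr => e' _; rewrite mulr_sumr.
by apply: eq_bigr => e _; rewrite mulrCA.
Qed.

Lemma expect_step D f :
  expect (step_level D) f = expect D (fun p => expect (step_product p) f).
Proof.
rewrite /expect /step_level big_allpairs_dep; apply: eq_bigr => e _.
by rewrite mulr_sumr; apply: eq_bigr => r _; rewrite mulrA.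
Qed.

Lemma expect_step_cons u p f : expect (step_product (u :: p)) f =
  expect (step_factor u) (fun o => expect (step_product p) (fun r => f (o ++ r))).
Proof.
rewrite /expect big_allpairs_dep; apply: eq_bigr => o _.
by rewrite mulr_sumr; apply: eq_bigr => r _; rewrite mulrA.
Qed.

Lemma expect_dirac p f : expect [:: (p, 1)] f = f p.
Proof. by rewrite /expect big_seq1 mul1r. Qed.

Lemma expect_step_cat p q f : expect (step_product (p ++ q)) f =
  expect (step_product p) (fun p' => expect (step_product q) (fun q' => f (p' ++ q'))).
Proof.
elim: p f => [|u p IH] f; first by rewrite expect_dirac.
rewrite cat_cons !expect_step_cons; apply: expect_eq => o; rewrite IH.
by apply: expect_eq => p'; apply: expect_eq => q'; rewrite catA.
Qed.

(** The branching property: the factors of a product evolve independently. *)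
Lemma offspring_cat n p q f : expect (offspring n (p ++ q)) f =
  expect (offspring n p) (fun p' => expect (offspring n q) (fun q' => f (p' ++ q'))).
Proof.
elim: n f => [|n IH] f; first by rewrite !expect_dirac.
rewrite /offspring !iterS -!/(offspring n _) !expect_step IH; apply: expect_eq => p'.
rewrite [RHS]expect_exchange expect_step; apply: expect_eq => q'.
by rewrite expect_step_cat expect_exchange.
Qed.

Lemma expect_iter n D f :
  expect (iter n step_level D) f = expect D (fun p => expect (offspring n p) f).
Proof.
elim: n f => [|n IH] f; first by apply: expect_eq => p; rewrite expect_dirac.
rewrite iterS expect_step IH; apply: expect_eq => p.
by rewrite /offspring iterS expect_step.
Qed.

Lemma offspringS n u f : expect (offspring n.+1 [:: u]) f =
  expect (step_factor u) (fun p => expect (offspring n p) f).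
Proof.
rewrite /offspring iterSr expect_iter expect_step expect_dirac expect_step_cons.
by apply: expect_eq => o; rewrite expect_dirac cats0.
Qed.

Definition ty (b b' : bool) : ftype :=
  if b then (if b' then nn else ns) else (if b' then sn else ss).

Definition degrees (p : fproduct) : seq nat := [seq f.2 | f <- p].

(** Functions of the multiset of cycle lengths. *)
Definition perm_inv (psi : seq nat -> rat) :=
  forall s s', perm_eq s s' -> psi s = psi s'.

Lemma cycle_type0 (g : 'S_(2 ^ 0)) : cycle_type g = [:: 1%N].
Proof.
apply: perm_small_eq => //; rewrite (permPl (cycle_type_sizes _)).
have -> : porbits g = [set [set: 'I_(2 ^ 0)]].
  apply/setP=> A; rewrite inE; apply/imsetP/eqP => [[z _ ->]|->].
    by apply/setP=> w; rewrite inE (ord_height0 w z) porbit_id.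
  have z : 'I_(2 ^ 0) by exact: ord0.
  by exists z => //; apply/setP=> w; rewrite inE (ord_height0 w z) porbit_id.
by rewrite enum_set1 /= cardsT card_ord.
Qed.

(** Two independent halves.  The law of a single factor is a hypothesis because
    this is used in the induction step that proves that law. *)
Lemma expect_offspring_pair n (psi : seq nat -> rat) b b' c c' d :
  (forall b b' psi d, perm_inv psi ->
    expect (offspring n [:: (ty b b', d)]) (psi \o degrees) =
    mean b b' (fun g : 'S_(2 ^ n) => psi (map (muln d) (cycle_type g)))) ->
  perm_inv psi ->
  expect (offspring n [:: (ty b b', d); (ty c c', d)]) (psi \o degrees) =
  mean b b' (fun g : 'S_(2 ^ n) => mean c c' (fun h : 'S_(2 ^ n) =>
    psi (map (muln d) (cycle_type g ++ cycle_type h)))).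
Proof.
move=> IH psi_inv; rewrite (offspring_cat n [:: _] [:: _]).
pose psi1 s := expect (offspring n [:: (ty c c', d)]) (fun q => psi (s ++ degrees q)).
have psi1_inv : perm_inv psi1.
  by move=> s s' eqs; apply: expect_eq => q; apply: psi_inv; rewrite perm_cat2r.
transitivity (expect (offspring n [:: (ty b b', d)]) (psi1 \o degrees)).
  apply: expect_eq => p; apply: expect_eq => q /=; by rewrite /degrees map_cat.
rewrite IH //; apply: mean_eq => g _.
rewrite -[LHS]/(expect _ ((fun s => psi (_ ++ s)) \o degrees)) IH.
  by apply: mean_eq => h _; rewrite map_cat.
by move=> s s' eqs; apply: psi_inv; rewrite perm_cat2l.
Qed.

Lemma offspring_swap n u v psi : perm_inv psi ->
  expect (offspring n [:: u; v]) (psi \o degrees) =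
  expect (offspring n [:: v; u]) (psi \o degrees).
Proof.
move=> psi_inv; rewrite (offspring_cat n [:: u] [:: v]) (offspring_cat n [:: v] [:: u]).
rewrite expect_exchange; apply: expect_eq => q; apply: expect_eq => p /=.
by apply: psi_inv; rewrite /degrees !map_cat perm_catC.
Qed.

(** The step of Model 3 for [t, d] is the recursion of [mean]: for t = nn, ns the
    lengths double and the coin c becomes irrelevant by translation invariance,
    for t = ss, sn the cycles of the halves are put together. *)
Lemma expect_offspring n b b' psi d : perm_inv psi ->
  expect (offspring n [:: (ty b b', d)]) (psi \o degrees) =
  mean b b' (fun g : 'S_(2 ^ n) => psi (map (muln d) (cycle_type g))).
Proof.
elim: n b b' psi d => [|n IH] b b' psi d psi_inv.
  by rewrite expect_dirac /= cycle_type0 /= muln1.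
rewrite offspringS /=; case: b.
  transitivity (expect (offspring n [:: (ty b' b', (2 * d)%N)]) (psi \o degrees)).
    by case: b'; rewrite /= expect_dirac.
  rewrite IH //; set X := mean _ _ _.
  have E c : mean c c (fun g : 'S_(2 ^ n) => mean (c (+) b') (c (+) b')
      (fun h => psi (map (muln d) (cycle_type (wr g h true))))) = X.
    rewrite -[RHS](@mean_cst n c c); apply: mean_eq => g Tg.
    rewrite /X -[b' in X in _ = X](addKb c) [c (+) (c (+) b')]addbC.
    rewrite -(mean_mulr _ _ _ Tg); apply: mean_eq => h _.
    apply: psi_inv; rewrite (permPl (perm_map _ (cycle_type_wr1 _ _))) -map_comp.
    by rewrite (@eq_map _ _ _ (muln (2 * d))) // => k /=; lia.
  by under eq_bigr => c _ do rewrite E; rewrite big_bool /=; field.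
have E c : mean c c (fun g : 'S_(2 ^ n) => mean (c (+) b') (c (+) b')
      (fun h => psi (map (muln d) (cycle_type (wr g h false))))) =
    expect (offspring n [:: (ty c c, d); (ty (c (+) b') (c (+) b'), d)]) (psi \o degrees).
  rewrite expect_offspring_pair //; apply: mean_eq => g _; apply: mean_eq => h _.
  by apply: psi_inv; rewrite perm_map // cycle_type_wr0.
under eq_bigr => c _ do rewrite E.
rewrite big_bool /=; case: b' {E} => /=.
  by rewrite expect_dirac (@offspring_swap n (ss, d)) //; field.
by rewrite /expect big_cons big_seq1 /= mulrDr.
Qed.

(** If e swaps, h g has type (1 + b + b', 1 + b + b') with 1 odd, whence
    [nn, 2] and [ss, 2]; otherwise the halves contribute [t, 1][t', 1] with t'
    the mirror image of t. *)
Lemma expect_model3 n psi : perm_inv psi ->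
  expect (model3 n.+1) (psi \o degrees) =
  meanM (fun g : 'S_(2 ^ n.+1) => psi (cycle_type g)).
Proof.
move=> psi_inv; rewrite /model3 expect_iter /meanM.
pose X t := expect (offspring n [:: (t, 2%N)]) (psi \o degrees).
pose Y t t' := expect (offspring n [:: (t, 1%N); (t', 1%N)]) (psi \o degrees).
have E1 b b' : mean b b' (fun g : 'S_(2 ^ n) => mean (b' (+) true) (b (+) true)
    (fun h => psi (cycle_type (wr g h true)))) =
    X (ty (~~ (b (+) b')) (~~ (b (+) b'))).
  rewrite /X expect_offspring //; set Z := mean (~~ _) _ _.
  rewrite -[RHS](@mean_cst n b b').
  apply: mean_eq => g Tg.
  have -> : Z = mean ((b' (+) true) (+) b) ((b (+) true) (+) b')
      (fun g : 'S_(2 ^ n) => psi (map (muln 2) (cycle_type g))).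
    by rewrite /Z; case: (b) (b') => [] [].
  rewrite -(mean_mulr _ _ _ Tg); apply: mean_eq => h _.
  by apply: psi_inv; apply: cycle_type_wr1.
have E0 b b' : mean b b' (fun g : 'S_(2 ^ n) => mean (b' (+) false) (b (+) false)
    (fun h => psi (cycle_type (wr g h false)))) = Y (ty b b') (ty b' b).
  rewrite /Y !addbF expect_offspring_pair //; last by move=> *; apply: expect_offspring.
  apply: mean_eq => g _; apply: mean_eq => h _; apply: psi_inv.
  by rewrite (@eq_map _ _ _ id) ?map_id ?cycle_type_wr0 // => k; rewrite mul1n.
rewrite [in RHS]big_bool /=.
under [X in _ = _ * (X + _)]eq_bigr => b _ do under eq_bigr => b' _ do rewrite E1.
under [X in _ = _ * (_ + X)]eq_bigr => b _ do under eq_bigr => b' _ do rewrite E0.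
rewrite !big_bool /= /expect /level1 !big_cons big_nil /=.
rewrite -[LHS]/(1 / 4%:R * X nn + (1 / 4%:R * X ss + (1 / 8%:R * Y nn nn +
  (1 / 8%:R * Y ss ss + (1 / 4%:R * Y ns sn + 0))))).
have -> : Y sn ns = Y ns sn by exact: offspring_swap.
by field.
Qed.

End Model.

Theorem theoremB (n : nat) (n_gt0 : (0 < n)%N)
    (lam : seq nat) (lam_part : is_partition (2 ^ n) lam) :
  proportion (grpM n) lam = cycle_density n lam.
Proof.
case: n n_gt0 lam_part => // n _ /andP[lam_sorted _].
pose psi (s : seq nat) : rat := (perm_eq s lam)%:R%R.
have psi_inv : perm_inv psi by move=> s s' eqs; rewrite /psi (permPl eqs).
transitivity (expect (model3 n.+1) (psi \o degrees)).
  rewrite expect_model3 // meanM_uniform /proportion; congr (_ / _)%R.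
  rewrite -sum1_card GRing.natr_sum big_mkcond [RHS]big_mkcond /=; apply: eq_bigr => g _.
  rewrite inE /psi; case: (g \in _) => //=.
  have -> : perm_eq (cycle_type g) lam = (cycle_type g == lam).
    apply/idP/eqP => [eq_lam|->//].
    apply: (sorted_eq _ _ _ lam_sorted eq_lam).
    - by move=> a b c /= ? ?; lia.
    - by move=> a b /= ?; lia.
    by apply: sort_sorted => a b /=; lia.
  by case: eqP.
rewrite /expect /cycle_density [RHS]big_mkcond; apply: eq_bigr => e _ /=.
by rewrite /psi /degrees; case: ifP => _; rewrite ?GRing.mulr1 ?GRing.mulr0.
Qed.
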